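(* There is a compact Haar-$2$ subset of $\mathbb{R}$ which is not a countable union of closed Haar-$1$ subsets of $\mathbb{R}$; moreover, it cannot be covered by countably many closed Haar-$1$ subsets of $\mathbb{R}$.
   Context: A Cantor set is a homeomorphic copy of $2^\omega$. For $n\geq 1$, a set $A\subseteq\mathbb{R}$ is Haar-$n$ if there are a Borel set $B\subseteq\mathbb{R}$ with $A\subseteq B$ and a Cantor set $D\subseteq\mathbb{R}$ such that $|(D+x)\cap B|\leq n$ for all $x\in\mathbb{R}$. *)

(* Defs.v *)
From mathcomp Require Import all_boot all_order all_algebra.
From mathcomp Require Import all_classical all_reals all_analysis.

Set Implicit Arguments.
Unset Strict Implicit.
Unset Printing Implicit Defensive.

Import Order.TTheory GRing.Theory Num.Theory.
Import numFieldNormedType.Exports.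

Local Open Scope classical_set_scope.
Local Open Scope card_scope.
Local Open Scope ring_scope.

(* [f] is a homeomorphism from [cantor_space] (that is, 2^omega with the
   product topology) onto [D] with the subspace topology, with inverse [g]. *)
Definition cantor_set (R : realType) (D : set R) : Prop :=
  exists (f : cantor_space -> R) (g : R -> cantor_space),
    [/\ f @` [set: cantor_space] = D, cancel f g,
        continuous f & {within D, continuous g}].

Definition borel (R : realType) (B : set R) : Prop := <<s [set U : set R | open U] >> B.

Definition translate (R : realType) (D : set R) (x : R) : set R :=
  [set d + x | d in D].

(* Intended for [n >= 1]. *)
Definition haar (n : nat) (R : realType) (A : set R) : Prop :=
  exists B D : set R,
    [/\ borel B, A `<=` B, cantor_set D &
        forall x : R, translate D x `&` B #<= `I_n].

(* Main.v *)
(* K is the ternary Cantor set {sum a_k 3^-k : a_k in {0, 1}}.  Since every real of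
   [-3/2, 3/2] has an expansion with digits -1, 0, 1, the difference set of each
   cylinder of K is a neighbourhood of 0, so a cylinder is never Haar-1: every Cantor
   set has arbitrarily close points.  By Baire's argument, if countably many closed
   sets cover K then one of them contains a cylinder.
   On the other hand K is Haar-2.  Modulo 3, 3^n K lies in an arc of length 3/2, which
   cannot contain three points that are nearly equally spaced on the circle R/3Z.  It
   thus suffices to take for D a Cantor set any three points of which have, at some
   place, the ternary digits 0, 1, 2, each followed by a digit 0. *)
Require Import Defs.
From mathcomp Require Import all_boot all_order all_algebra.
From mathcomp Require Import all_classical all_reals all_analysis.
From mathcomp Require Import ring lra zify.

Import numFieldNormedType.Exports.
Import Order.TTheory GRing.Theory Num.Theory.

Set Implicit Arguments.
Unset Strict Implicit.
Unset Printing Implicit Defensive.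

Local Open Scope classical_set_scope.

(** * Base-3 expansions with bounded digits *)

Section Expansions.
Local Open Scope ring_scope.
Variable R : realType.
Implicit Types c : nat -> nat.

(** Weights start at $3^0$ and digits are not restricted to 0, 1, 2; a bound $m$ on them ensures
    convergence, with values in $[0, 3m/2]$. *)
Definition ternary c : R := limn (series (fun k => (c k)%:R / 3 ^+ k : R)).

Definition shift n c : nat -> nat := fun k => c (n + k)%N.

Fixpoint head n c : nat := if n is n'.+1 then (3 * head n' c + c n')%N else 0%N.

Lemma eq_head n c c' : (forall i, (i < n)%N -> c i = c' i) -> head n c = head n c'.
Proof.
elim: n => //= n IH cc'; rewrite cc' // IH // => i /ltnW; exact: cc'.
Qed.

Lemma series_ternary_le m c n : (forall k, (c k <= m)%N) ->
  series (fun k => (c k)%:R / 3 ^+ k : R) n <= m%:R * (3 / 2 - 3 / 2 / 3 ^+ n).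
Proof.
move=> cm; elim: n => [|n IH]; first by rewrite /series /= big_geq // expr0; lra.
rewrite seriesSr.
have : (c n)%:R <= m%:R :> R by rewrite ler_nat.
have p : 0 < (3 ^+ n : R)^-1 by rewrite invr_gt0 exprn_gt0.
move=> /(fun h => ler_wpM2r (ltW p) h); move: IH.
rewrite exprS invfM; lra.
Qed.

Lemma is_cvg_ternary m c : (forall k, (c k <= m)%N) ->
  cvgn (series (fun k => (c k)%:R / 3 ^+ k : R)).
Proof.
move=> cm; apply: nondecreasing_is_cvgn.
  by apply/nondecreasing_series => i _; rewrite divr_ge0 ?exprn_ge0.
exists (m%:R * (3 / 2)) => _ [n _ <-].
apply: le_trans (series_ternary_le n cm) _.
by rewrite ler_wpM2l // gerBl divr_ge0 ?exprn_ge0 //; lra.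
Qed.

Lemma ternary_ge0 c m : (forall k, (c k <= m)%N) -> 0 <= ternary c.
Proof.
move=> cm; apply: limr_ge; first exact: is_cvg_ternary cm.
by apply: nearW => n; apply: sumr_ge0 => i _; rewrite divr_ge0 ?exprn_ge0.
Qed.

Lemma ternary_le c m : (forall k, (c k <= m)%N) -> ternary c <= m%:R * (3 / 2).
Proof.
move=> cm; apply: limr_le; first exact: is_cvg_ternary cm.
apply: nearW => n; apply: le_trans (series_ternary_le n cm) _.
by rewrite ler_wpM2l // gerBl divr_ge0 ?exprn_ge0 //; lra.
Qed.

Lemma ternary_rec c m : (forall k, (c k <= m)%N) ->
  ternary c = (c 0%N)%:R + ternary (shift 1 c) / 3.
Proof.
move=> cm; apply: cvg_lim => //; rewrite -cvg_shiftS /=.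
have cs : forall k, (shift 1 c k <= m)%N by move=> k; exact: cm.
have E n : (c 0%N)%:R + series (fun k => (shift 1 c k)%:R / 3 ^+ k : R) n / 3 =
    series (fun k => (c k)%:R / 3 ^+ k : R) n.+1.
  rewrite /series /= big_nat_recl // expr0 divr1; congr (_ + _).
  rewrite mulr_suml; apply: eq_bigr => i _.
  by rewrite /shift add1n exprS invfM; ring.
under eq_fun do rewrite -E.
apply: cvgD; first exact: cvg_cst.
by apply: cvgMr_tmp; exact: is_cvg_ternary cs.
Qed.

(** Modulo 3, multiplying by $3^n$ just shifts the digits: this is the source of all later arguments
    on the circle $\mathbb{R}/3\mathbb{Z}$. *)
Lemma ternary_scale c m n : (forall k, (c k <= m)%N) ->
  3 ^+ n * ternary c = 3 * (head n c)%:R + ternary (shift n c).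
Proof.
move=> cm; elim: n => [|n IH]; first by rewrite expr0 mul1r /= mulr0 add0r.
rewrite exprS -mulrA IH (@ternary_rec (shift n c) m); last by move=> k; exact: cm.
have -> : shift 1 (shift n c) = shift n.+1 c.
  by apply/funext => k; rewrite /shift addnA addn1.
have -> : shift n c 0%N = c n by rewrite /shift addn0.
rewrite /= natrD natrM; lra.
Qed.

(** After scaling by $3^n$ the equal heads cancel, leaving two tails in $[0, 3m/2]$. *)
Lemma ternary_dist c c' m n : (forall k, (c k <= m)%N) -> (forall k, (c' k <= m)%N) ->
  (forall i, (i < n)%N -> c i = c' i) ->
  `|ternary c - ternary c'| <= m%:R * (3 / 2) / 3 ^+ n.
Proof.
move=> cm cm' cc'; rewrite ler_pdivlMr ?exprn_gt0 //.
rewrite -[X in _ * X]ger0_norm ?exprn_ge0 // -normrM mulrC mulrBr.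
rewrite (ternary_scale n cm) (ternary_scale n cm') (eq_head cc').
have s : forall k, (shift n c k <= m)%N by move=> k; exact: cm.
have s' : forall k, (shift n c' k <= m)%N by move=> k; exact: cm'.
have := (ternary_ge0 s, ternary_ge0 s', ternary_le s, ternary_le s').
move=> [[[? ?] ?] ?]; rewrite ler_norml; lra.
Qed.

Lemma ternary_tail m (eps : R) : 0 < eps -> exists n, m%:R * (3 / 2) / 3 ^+ n < eps.
Proof.
move=> eps0.
have : (fun n => m%:R * (3 / 2) * (3^-1) ^+ n : R) @ \oo --> (m%:R * (3 / 2) * 0 : R).
  apply: cvgMl_tmp; apply: cvg_expr; rewrite ger0_norm; lra.
rewrite mulr0 => /cvgrPdist_lt /(_ _ eps0) [n _ /(_ n (leqnn n))].
rewrite /= sub0r normrN exprVn => h; exists n; apply: le_lt_trans h; exact: ler_norm.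
Qed.

Lemma near_forall_lt (T : Type) (F : set_system T) {FF : Filter F} (P : nat -> T -> Prop) n :
  (forall i, \forall x \near F, P i x) ->
  \forall x \near F, forall i, (i < n)%N -> P i x.
Proof.
move=> FP; elim: n => [|n IH]; first by apply: nearW => x i; rewrite ltn0.
apply: filterS2 IH (FP n) => x h hn i.
by rewrite ltnS leq_eqVlt => /predU1P[->//|]; exact: h.
Qed.

Lemma near_cylinder n (e : cantor_space) :
  \forall e' \near e, forall i, (i < n)%N -> e' i = e i.
Proof.
apply: (@near_forall_lt _ (nbhs e) _ (fun i e' => e' i = e i)) => i.
by apply: (@proj_continuous nat (fun=> bool) i e [set e i]); exact: discrete_set1.
Qed.

Lemma continuous_ternary (C : cantor_space -> nat -> nat) m :
  (forall e k, (C e k <= m)%N) ->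
  (forall k e, \forall e' \near e, C e' k = C e k) ->
  continuous (fun e => ternary (C e)).
Proof.
move=> Cm Cloc e; apply/cvgrPdist_lt => eps eps0.
have [n nP] := ternary_tail m eps0.
apply: filterS (near_forall_lt n (fun i => Cloc i e)) => e' h; apply: le_lt_trans nP.
by apply: ternary_dist => // i /h.
Qed.

End Expansions.

(** * Sets with at most one or two points *)

Section Cardinality.
Local Open Scope card_scope.
Variable T : choiceType.
Implicit Types (A : set T) (x y z : T).

Lemma card_le1_eq A x y : A #<= `I_1 -> A x -> A y -> x = y.
Proof.
move=> /pcard_leP[f] Ax Ay; apply: (@inj _ _ _ f); rewrite ?inE //.
have := (@funS _ _ _ _ f x Ax, @funS _ _ _ _ f y Ay).
by rewrite /= !ltnS !leqn0 => -[/eqP -> /eqP ->].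
Qed.

Lemma card_le2 A :
  (forall x y z, A x -> A y -> A z -> [\/ x = y, y = z | x = z]) -> A #<= `I_2.
Proof.
move=> A3; have [->|/set0P[p Ap]] := eqVneq A set0; first exact: card_ge0.
(* Sending one chosen point to 0 and all others to 1 is injective on [A]. *)
pose f x : nat := x != p.
apply/pcard_leP/injfunPex; exists f; first by move=> x _; rewrite /f /=; case: (x != p).
move=> x y /set_mem Ax /set_mem Ay; rewrite /f.
have [->|/eqP xp] := eqVneq x p; have [->|/eqP yp] := eqVneq y p => // _.
by have [/esym|//|/esym] := A3 _ _ _ Ap Ax Ay.
Qed.

End Cardinality.

(** * Cantor sets in the line *)

Section CantorSets.
Local Open Scope ring_scope.
Variable R : realType.

Lemma cantor_set_range (f : cantor_space -> R) :
  injective f -> continuous f -> cantor_set (f @` setT).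
Proof.
move=> finj fcont.
pose g x : cantor_space := xget point [set e | f e = x].
have fK : cancel f g.
  by move=> e; apply: finj; exact: (@xgetI _ point [set e' | f e' = f e] e erefl).
exists f, g; split=> //; apply/continuous_closedP => A cA.
(* Within the range of [f], the preimage of [A] under [g] is the image of [A] under [f], which is
   compact and hence closed. *)
apply/closed_subspaceP; exists (f @` A).
  apply: (compact_closed (@Rhausdorff R)); apply: continuous_compact.
    exact: continuous_subspaceT.
  apply: (subclosed_compact cA cantor_space_compact); exact: subsetT.
rewrite eqEsubset; split => [_ [[e Ae <-] De]|_ [] /[swap] -[e _ <-] gA].
  by split=> //; change (A (g (f e))); rewrite fK.
by split; [exists e => //; rewrite -(fK e)|exists e].
Qed.

Lemma closed_borel (K : set R) : closed K -> borel K.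
Proof.
move=> cK; rewrite -(setCK K) -setTD; apply: (sigma_algebraCD).
apply: sub_sigma_algebra; exact: closed_openC.
Qed.

Lemma cantor_set_gap (D : set R) (eps : R) : cantor_set D -> 0 < eps ->
  exists d d', [/\ D d, D d', d != d' & `|d - d'| < eps].
Proof.
move=> [f [g [<- fK fcont _]]] eps0; pose e : cantor_space := point.
have lime : limit_point [set: cantor_space] e by have [_ ->] := cantor_perfect.
have /cvgrPdist_lt /(_ _ eps0) U := fcont e.
have [e' [/eqP ee' _ h]] := lime _ U.
exists (f e), (f e'); split; [by exists e|by exists e'| |exact: h].
by apply/eqP => /(can_inj fK) /esym.
Qed.
End CantorSets.

(** * The 0-1 digit set and its cylinders *)

Section Construction.
Local Open Scope ring_scope.
Local Open Scope card_scope.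
Variable R : realType.
Implicit Types e : cantor_space.

Definition bits e : nat -> nat := fun k => e k.

Definition agree n e e' := forall i, (i < n)%N -> e i = e' i.

Lemma bits_le1 e k : (bits e k <= 1)%N. Proof. exact: leq_b1. Qed.

Local Notation V e := (ternary R (bits e)).

Lemma continuous_bits : continuous (fun e => V e).
Proof.
apply: continuous_ternary bits_le1 _ => k e.
by apply: filterS (near_cylinder k.+1 e) => e' /(_ k (ltnSn k)); rewrite /bits => ->.
Qed.

Lemma le0_of_scale (x C : R) : (forall n, 3 ^+ n * x <= C) -> x <= 0.
Proof.
move=> h; rewrite leNgt; apply/negP => x0.
have := @archi_boundP _ (`|C| / x); rewrite divr_ge0 // ?ltW // => /(_ isT).
set n := Num.bound _; rewrite ltr_pdivrMr // => nx; have := h n; apply/negP.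
rewrite -ltNge; apply: le_lt_trans (ler_norm C) _; apply: lt_trans nx _.
by rewrite ltr_pM2r // -natrX ltr_nat ltn_expl.
Qed.

(* Balanced ternary expansion of [s]: a digit -1, 0 or 1 is a difference of two bits. *)
Lemma bits_difference (s : R) : `|s| <= 3 / 2 -> exists e e', V e - V e' = s.
Proof.
move=> hs.
pose step r : R := 3 * (r - (1 / 2 < r)%R%:R + (r < - (1 / 2))%R%:R).
pose r k := iter k step s.
have rle k : `|r k| <= 3 / 2.
  elim: k => //= k; rewrite -/(r k) /step !ler_norml => /andP[? ?].
  by case: ltP => ?; case: ltP => ? /=; lra.
pose e : cantor_space := fun k => (1 / 2 < r k)%R.
pose e' : cantor_space := fun k => (r k < - (1 / 2))%R.
(* [d k] is the error at stage [k]. It stays bounded although it equals $3^k$ times [d 0], so [d 0]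
   vanishes. *)
pose d k := ternary R (shift k (bits e)) - ternary R (shift k (bits e')) - r k.
have sb a k i : (shift k (bits a) i <= 1)%N by exact: bits_le1.
have dS k : d k = d k.+1 / 3.
  rewrite /d (ternary_rec R (sb e k)) (ternary_rec R (sb e' k)).
  have sS a : shift 1 (shift k (bits a)) = shift k.+1 (bits a).
    by apply/funext => i; rewrite /shift addnA addn1.
  rewrite !sS /= -/(r k) /step /shift !addn0 /bits /e /e'; lra.
have dE k : 3 ^+ k * d 0%N = d k.
  elim: k => [|k IH]; first by rewrite expr0 mul1r.
  by rewrite exprS -mulrA IH (dS k); field.
have db k : `|d k| <= 9 / 2.
  have := (ternary_ge0 R (sb e k), ternary_ge0 R (sb e' k), ternary_le R (sb e k),
    ternary_le R (sb e' k), rle k).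
  rewrite /d !ler_norml => -[[[[? ?] ?] ?] /andP[? ?]]; lra.
exists e, e'; suff : d 0%N = 0 by rewrite /d /= => /eqP; rewrite subr_eq0 => /eqP.
apply/eqP; rewrite -normr_le0; apply: (@le0_of_scale _ (9 / 2)) => n.
by rewrite -[X in X * _]ger0_norm ?exprn_ge0 // -normrM dE.
Qed.

(** Realise $3^n t$ as a difference of two points, then prefix both with the first [n] bits of [e0],
    whose contributions cancel. *)
Lemma cylinder_difference n e0 (t : R) : `|t| <= 3 / 2 / 3 ^+ n ->
  exists e e', [/\ agree n e e0, agree n e' e0 & V e - V e' = t].
Proof.
rewrite ler_pdivlMr ?exprn_gt0 //.
rewrite -[X in _ * X](ger0_norm (exprn_ge0 _ _)) // -normrM => /bits_difference.
move=> [a [a' aa']].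
pose ext (b : cantor_space) : cantor_space :=
  fun k => if (k < n)%N then e0 k else b (k - n)%N.
have extE b : 3 ^+ n * V (ext b) = 3 * (head n (bits e0))%:R + V b.
  rewrite (ternary_scale R n (bits_le1 _)); congr (3 * _%:R + ternary R _).
    by apply: eq_head => i; rewrite /bits /ext => ->.
  by apply/funext => i; rewrite /shift /bits /ext ltnNge leq_addr /= addKn.
exists (ext a), (ext a'); split; [by move=> i; rewrite /ext => ->..|].
apply: (@mulfI _ (3 ^+ n)); first by rewrite expf_neq0.
by rewrite mulrBr !extE [RHS]mulrC -aa'; ring.
Qed.

(** Two close enough points of [D] differ by exactly as much as some two points of the cylinder, so
    a single translate of [D] meets [B] twice. *)
Lemma haar1_cylinder (F : set R) n e0 : haar 1 F ->
  ~ (forall e, agree n e e0 -> F (V e)).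
Proof.
move=> [B [D [_ FB cD DB]]] h.
have eps0 : 0 < 3 / 2 / 3 ^+ n :> R by rewrite divr_gt0 ?exprn_gt0 //; lra.
have [d [d' [Dd Dd' /eqP dd' /ltW]]] := cantor_set_gap cD eps0.
move=> /(cylinder_difference e0)[e [e' [/h/FB Be /h/FB Be' ee']]].
have : V e = V e'.
  apply: (card_le1_eq (DB (V e - d))); split=> //; [exists d => //|exists d' => //]; lra.
move=> E; apply: dd'; lra.
Qed.

(** Baire's argument by hand: otherwise shrink cylinders successively so that the [i]-th choice
    avoids [F i]; their common point is then uncovered. A pair (length, point) encodes a
    cylinder. *)
Lemma closed_cover_cylinder (F : nat -> set R) :
  (forall i, closed (F i)) -> (forall e, exists i, F i (V e)) ->
  exists i n e0, forall e, agree n e e0 -> F i (V e).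
Proof.
move=> cF cov; apply: contrapT => no.
have step (p : nat * cantor_space) i : exists q : nat * cantor_space,
  [/\ (p.1 < q.1)%N, agree p.1 q.2 p.2 & forall e, agree q.1 e q.2 -> ~ F i (V e)].
  case: p => n e0 /=.
  have [e [ee0 Fe]] : exists e, agree n e e0 /\ ~ F i (V e).
    apply: contrapT => h; apply: no; exists i, n, e0 => e ee0.
    by apply: contrapT => Fe; apply: h; exists e.
  have /nbhs_ballP[eps /= eps0 epsF] : nbhs (V e) (~` F i).
    by apply: open_nbhs_nbhs; split=> //; exact: closed_openC.
  have [m mP] := ternary_tail 1 eps0.
  (* Length at least [n.+1] forces the lengths to grow; length at least [m] keeps the image inside
     the ball that avoids [F i]. *)
  exists (maxn n.+1 m, e) => /=; split=> [|//|e' ee']; first exact: leq_maxl.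
  apply: epsF; rewrite /ball /=; apply: le_lt_trans mP.
  apply: (@ternary_dist R _ _ 1); [exact: bits_le1..|].
  by move=> k km; rewrite /bits ee' // leq_max km orbT.
have {step} [next nextP] := choice (fun q => step q.1 q.2).
pose p k := iteri k (fun i q => next (q, i)) (0%N, point : cantor_space).
have pS k : p k.+1 = next (p k, k) by [].
have size_p k : (k <= (p k).1)%N.
  by elim: k => // k IH; rewrite pS; case: (nextP (p k, k)) => h _ _; exact: leq_ltn_trans h.
have size_mono k l : (k <= l)%N -> ((p k).1 <= (p l).1)%N.
  move=> /subnKC <-; elim: (l - k)%N => [|j IH]; first by rewrite addn0.
  rewrite addnS pS; case: (nextP (p (k + j)%N, (k + j)%N)) => /ltnW h _ _; exact: leq_trans h.
have p_agree k l : (k <= l)%N -> agree (p k).1 (p l).2 (p k).2.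
  move=> /subnKC <-; elim: (l - k)%N => [|j IH]; first by rewrite addn0.
  rewrite addnS pS; case: (nextP (p (k + j)%N, (k + j)%N)) => _ h _ i ik.
  by rewrite h ?IH //; apply: leq_trans ik _; apply: size_mono; exact: leq_addr.
(* Stage [k.+1] has length at least [k.+1], so bit [k] is already final there. *)
pose lim_e : cantor_space := fun k => (p k.+1).2 k.
have lim_agree k : agree (p k).1 lim_e (p k).2.
  move=> i ik; rewrite /lim_e; case: (leqP k i.+1) => h; first exact: (p_agree _ _ h).
  by rewrite (p_agree _ _ (ltnW h)) //; exact: size_p.
have [i] := cov lim_e; have := lim_agree i.+1; rewrite pS.
by case: (nextP (p i, i)) => _ _ h /h.
Qed.

(** * The Cantor set witnessing Haar-2 *)

(* Every pair of words [(u, v)] is coded by some [k], so that any three distinct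
   points of [2^omega] get the digits 0, 1, 2 at a common place. *)
Definition branch e k : nat :=
  if @unpickle (seq bool * seq bool)%type k is Some (u, v) then
    if u == mkseq e (size u) then 1%N else if v == mkseq e (size v) then 2%N else 0%N
  else 0%N.

Definition spread e k : nat := if odd k then 0%N else branch e k./2.

Local Notation W e := (ternary R (spread e)).

Lemma spread_le2 e k : (spread e k <= 2)%N.
Proof.
rewrite /spread /branch; case: ifP => // _; case: unpickle => // -[u v].
by case: ifP => // _; case: ifP.
Qed.

Lemma eq_mkseq e e' m n : (m <= n)%N -> agree n e e' -> mkseq e m = mkseq e' m.
Proof.
move=> mn ee'; apply/eq_in_map => i; rewrite mem_iota add0n => /andP[_ im].
by apply: ee'; exact: leq_trans im mn.
Qed.

Lemma continuous_spread : continuous (fun e => W e).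
Proof.
apply: continuous_ternary spread_le2 _ => k e; rewrite /spread /branch.
case: ifP => _; first by apply: (@filterE _ (nbhs e)) => e'.
case: unpickle => [[u v]|]; last by apply: (@filterE _ (nbhs e)) => e'.
(* The digit depends only on a prefix of [e] as long as the longer of the two coded words. *)
apply: filterS (near_cylinder (maxn (size u) (size v)) e) => e' ee'.
by rewrite (eq_mkseq (leq_maxl _ _) ee') (eq_mkseq (leq_maxr _ _) ee').
Qed.

(** Choose a length at which the three prefixes differ pairwise, and the code of the pair of
    prefixes of [e1] and [e2]. *)
Lemma branch_separates e0 e1 e2 : e0 <> e1 -> e1 <> e2 -> e0 <> e2 ->
  exists k, [/\ branch e0 k = 0%N, branch e1 k = 1%N & branch e2 k = 2%N].
Proof.
have sep e e' : e <> e' -> exists n, forall m, (n <= m)%N -> mkseq e m != mkseq e' m.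
  move=> ee'; have [i ei] : exists i, e i <> e' i.
    apply: contrapT => h; apply: ee'; apply/funext => i.
    by apply: contrapT => ?; apply: h; exists i.
  exists i.+1 => m im; apply/eqP => /(congr1 (fun s => nth false s i)).
  by rewrite !nth_mkseq.
move=> /sep[a ha] /sep[b hb] /sep[c hc]; pose m := maxn a (maxn b c).
exists (pickle (mkseq e1 m, mkseq e2 m)); rewrite /branch pickleK !size_mkseq eqxx.
rewrite eqxx ![_ == mkseq e0 m]eq_sym.
have [am bm cm] : [/\ a <= m, b <= m & c <= m]%N by split; rewrite /m; lia.
by rewrite (negbTE (ha m am)) (negbTE (hb m bm)) (negbTE (hc m cm)).
Qed.

Lemma bits_mod3 e n : exists (N : nat) (s : R),
  [/\ 0 <= s, s <= 3 / 2 & 3 ^+ n * V e = 3 * N%:R + s].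
Proof.
have sb k : (shift n (bits e) k <= 1)%N by exact: bits_le1.
exists (head n (bits e)), (ternary R (shift n (bits e))).
split; first exact: ternary_ge0 sb.
  by apply: le_trans (ternary_le R sb) _; lra.
exact: ternary_scale (bits_le1 e).
Qed.

(* The zero digits of [spread] at odd places are what makes the fractional part small. *)
Lemma spread_mod3 e k : exists (N : nat) (s : R),
  [/\ 0 <= s, s <= 1 / 3 & 3 ^+ k.*2 * W e = 3 * N%:R + (branch e k)%:R + s].
Proof.
have sb n i : (shift n (spread e) i <= 2)%N by exact: spread_le2.
have sS n : shift 1 (shift n (spread e)) = shift n.+1 (spread e).
  by apply/funext => i; rewrite /shift addnA addn1.
exists (head k.*2 (spread e)), (ternary R (shift k.*2.+2 (spread e)) / 9).
have := (ternary_ge0 R (sb k.*2.+2), ternary_le R (sb k.*2.+2)) => -[? ?].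
split; [lra|lra|].
rewrite (ternary_scale R _ (spread_le2 e)) (ternary_rec R (sb k.*2)) sS.
rewrite (ternary_rec R (sb k.*2.+1)) sS.
have -> : shift k.*2 (spread e) 0%N = branch e k.
  by rewrite /shift /spread addn0 odd_double doubleK.
have -> : shift k.*2.+1 (spread e) 0%N = 0%N.
  by rewrite /shift /spread addn0 /= odd_double.
lra.
Qed.

Lemma intr_norm_lt1 (z : int) : `|z%:~R : R| < 1 -> z%:~R = 0 :> R.
Proof.
by rewrite -intr_norm -[1]/(1%:~R) ltr_int => h; have -> : z = 0 by lia.
Qed.

Lemma spread_inj : injective (fun e => W e).
Proof.
move=> e e' /= E; apply: contrapT => ee'.
(* A third point is supplied so that [branch_separates] applies; it differs from [e] at bit 0 and
   from [e'] at bit 1. *)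
have [e2 [e02 e12]] : exists e2, e <> e2 /\ e' <> e2.
  pose e2 : cantor_space := fun k => if k is 0%N then ~~ e 0%N else ~~ e' k.
  exists e2; split => [/(congr1 (@^~ 0%N))|/(congr1 (@^~ 1%N))]; rewrite /e2 /=.
    by case: (e 0%N).
  by case: (e' 1%N).
have [k [b0 b1 _]] := branch_separates ee' e12 e02.
have [N [s [? ? NE]]] := spread_mod3 e k; have [N' [s' [? ? NE']]] := spread_mod3 e' k.
move: NE NE'; rewrite E b0 b1 => -> EE.
have := @intr_norm_lt1 (Posz N - Posz N'); rewrite intrB -!pmulrn.
(* Here $3(N - N') = 1 + s' - s$ lies in $[2/3, 4/3]$, which contains no multiple of 3. *)
have -> : `|N%:R - N'%:R : R| < 1 by rewrite ltr_norml; lra.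
move=> /(_ isT); lra.
Qed.

(* After scaling by [3 ^+ k.*2], points [V a] lie modulo 3 on an arc of length 3/2,
   while the three [W e] are, up to 1/3, equally spaced on the circle. *)
Lemma no_triple e0 e1 e2 a0 a1 a2 (x : R) : e0 <> e1 -> e1 <> e2 -> e0 <> e2 ->
  W e0 + x = V a0 -> W e1 + x = V a1 -> W e2 + x = V a2 -> False.
Proof.
move=> e01 e12 e02 E0 E1 E2.
have [k [b0 b1 b2]] := branch_separates e01 e12 e02.
have [M0 [t0 [? ? ]]] := spread_mod3 e0 k.
have [M1 [t1 [? ? ]]] := spread_mod3 e1 k.
have [M2 [t2 [? ? ]]] := spread_mod3 e2 k.
have [N0 [s0 [? ? ]]] := bits_mod3 a0 k.*2.
have [N1 [s1 [? ? ]]] := bits_mod3 a1 k.*2.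
have [N2 [s2 [? ? ]]] := bits_mod3 a2 k.*2.
rewrite b0 b1 b2 -E0 -E1 -E2 !mulrDr => + + + F2 F1 F0.
rewrite F0 F1 F2 => G0 G1 G2.
(* Three times this integer is $s_1 - s_0 - 1 - t_1 + t_0$, of absolute value below 3, so it is 0;
   likewise for the next pair. Adding, $s_2 - s_0 = 2 + t_2 - t_0 \ge 5/3$, which exceeds $3/2$. *)
have := @intr_norm_lt1 (Posz M1 - Posz M0 - Posz N1 + Posz N0).
have := @intr_norm_lt1 (Posz M2 - Posz M1 - Posz N2 + Posz N1).
rewrite !(intrD, mulrNz) -!pmulrn.
have -> : `|M2%:R - M1%:R - N2%:R + N1%:R : R| < 1 by rewrite ltr_norml; lra.
have -> : `|M1%:R - M0%:R - N1%:R + N0%:R : R| < 1 by rewrite ltr_norml; lra.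
move=> /(_ isT) + /(_ isT); lra.
Qed.

(** * The compact set and its two properties *)

Definition bits_set : set R := (fun e => V e) @` setT.

Lemma compact_bits_set : compact bits_set.
Proof.
apply: continuous_compact; last exact: cantor_space_compact.
apply: continuous_subspaceT; exact: continuous_bits.
Qed.

Lemma haar2_bits_set : haar 2 bits_set.
Proof.
exists bits_set, ((fun e => W e) @` setT); split=> //.
- by apply: closed_borel; apply: compact_closed (@Rhausdorff R) compact_bits_set.
- exact: cantor_set_range spread_inj continuous_spread.
move=> x; apply: card_le2 => _ _ _ [[_ [e0 _ <-] <-] [a0 _ h0]]
  [[_ [e1 _ <-] <-] [a1 _ h1]] [[_ [e2 _ <-] <-] [a2 _ h2]].
have [->|/eqP e01] := eqVneq e0 e1; first exact: Or31.
have [->|/eqP e12] := eqVneq e1 e2; first exact: Or32.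
have [->|/eqP e02] := eqVneq e0 e2; first exact: Or33.
by have := no_triple e01 e12 e02 (esym h0) (esym h1) (esym h2).
Qed.

Lemma bits_set_not_covered (F : nat -> set R) :
  (forall i, closed (F i) /\ haar 1 (F i)) -> ~ bits_set `<=` \bigcup_i F i.
Proof.
move=> FP sub.
have [||i [n [e0 h]]] := @closed_cover_cylinder F.
- by move=> i; case: (FP i).
- by move=> e; have [|i _ ?] := sub (V e); [exists e|exists i].
- by case: (FP i) => _ /haar1_cylinder; apply; exact: h.
Qed.

End Construction.

Theorem corollary4p2 (R : realType) :
  exists K : set R,
    [/\ compact K,
        haar 2 K,
        ~ (exists F : nat -> set R,
             (forall i, closed (F i) /\ haar 1 (F i)) /\
             K = \bigcup_i F i) &
        ~ (exists F : nat -> set R,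
             (forall i, closed (F i) /\ haar 1 (F i)) /\
             K `<=` \bigcup_i F i)].
Proof.
exists (@bits_set R); split; [exact: compact_bits_set|exact: haar2_bits_set| |].
- by move=> [F [FP KF]]; apply: (bits_set_not_covered FP); rewrite KF.
- by move=> [F [FP KF]]; exact: (bits_set_not_covered FP).
Qed.
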